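(* Let $\mathcal A$ be an $\mathbb F$-algebra and let $A\in\mathcal A$. Assume that $\mathcal A$ is $A$-standard. Then each of the maps $S$ and $S'$ acts on $\mathcal A$ as an ($\mathbb F$-algebra) automorphism, and these automorphisms are inverses of each other.
   Context: Let $\mathbb F$ be a field and fix $0\neq q\in\mathbb F$ that is not a root of unity. Algebras are associative with $1$. Let $\mathcal A$ be an $\mathbb F$-algebra and $A\in\mathcal A$. For $r\in\mathbb Z$, $\mathrm{ad}_rA:\mathcal A\to\mathcal A$ is the $\mathbb F$-linear map $X\mapsto q^rAX-q^{-r}XA$, and $\mathrm{ad}\,A=\mathrm{ad}_0A$. These maps mutually commute; products of maps are compositions and $I$ is the identity map. Define $$\mathrm{bad}_0A=\frac{\mathrm{ad}\,A}{q-q^{-1}},\qquad \mathrm{bad}_nA=\frac{(q^{2n}-q^{-2n})^2I+(\mathrm{ad}_nA)(\mathrm{ad}_{-n}A)}{(q^{2n}-q^{-2n})(q^{2n+1}-q^{-2n-1})}\quad(n\ge1),$$ $$(\mathrm{bad}\,A)_n=\prod_{i=0}^{n-1}\mathrm{bad}_iA\quad(n\ge0),\qquad(\mathrm{bad}\,A)_0=I,$$ and $S_0=S'_0=I$, $$S_n=\frac{(\mathrm{bad}\,A)_n\,\mathrm{ad}_nA}{q^{2n}-q^{-2n}},\qquad S'_n=\frac{(\mathrm{bad}\,A)_n\,\mathrm{ad}_{-n}A}{q^{2n}-q^{-2n}}\quad(n\ge1).$$ Define the formal sums $S=\sum_{n\ge0}S_n$ and $S'=\sum_{n\ge0}S'_n$.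 An element $X\in\mathcal A$ is called $A$-standard if there is a positive integer $n$ with $(\mathrm{bad}\,A)_n(X)=0$ (then $(\mathrm{bad}\,A)_m(X)=0$ for all $m\ge n$, so $S(X)$ and $S'(X)$ are finite sums). The algebra $\mathcal A$ is called $A$-standard if every element of $\mathcal A$ is $A$-standard. *)

(* Defs.v *)
From mathcomp Require Import all_boot all_order all_algebra.
From mathcomp Require Import classical_sets fsbigop.

Set Implicit Arguments.
Unset Strict Implicit.
Unset Printing Implicit Defensive.

Import GRing.Theory.
Local Open Scope ring_scope.

Section Defs.
Variables (F : fieldType) (q : F) (AA : algType F) (A : AA).
Implicit Types (X : AA) (n : nat).

Definition ad (r : int) X : AA := q ^ r *: (A * X) - q ^ (- r) *: (X * A).

Definition qdiff (m : nat) : F := q ^+ m - q ^- m.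

Definition bad n X : AA :=
  if n is 0 then (qdiff 1)^-1 *: ad 0 X
  else (qdiff (2 * n) * qdiff (2 * n + 1))^-1 *:
         (qdiff (2 * n) ^+ 2 *: X + ad n%:Z (ad (- n%:Z) X)).

(* (bad A)_n, the product (composition) of bad_0 A, ..., bad_(n-1) A *)
Definition badp n : AA -> AA := \big[comp/id]_(0 <= i < n) bad i.

Definition Sterm n X : AA :=
  if n is 0 then X else (qdiff (2 * n))^-1 *: badp n (ad n%:Z X).

Definition Sterm' n X : AA :=
  if n is 0 then X else (qdiff (2 * n))^-1 *: badp n (ad (- n%:Z) X).

(* [\sum_(n \in setT)] sums the nonzero terms when there are finitely many of
   them, which is the case at every A-standard X (the library returns 0 when
   there are infinitely many). *)
Definition Ssum X : AA := \sum_(n \in @setT nat) Sterm n X.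

Definition Ssum' X : AA := \sum_(n \in @setT nat) Sterm' n X.

Definition standard_elt X : Prop := exists2 n, (0 < n)%N & badp n X = 0.

Definition standard_alg : Prop := forall X, standard_elt X.

End Defs.

Definition not_root_of_unity (F : fieldType) (q : F) : Prop :=
  forall n : nat, (0 < n)%N -> q ^+ n != 1.

Definition alg_automorphism (F : fieldType) (AA : algType F) (f : AA -> AA) :
  Prop := [/\ linear f, monoid_morphism f & bijective f].

(* Main.v *)
Require Import Defs.
From HB Require Import structures.
From mathcomp Require Import all_boot all_order all_algebra.
From mathcomp Require Import classical_sets fsbigop.
From mathcomp Require Import ring zify.

(** Left and right multiplication by [A] commute, so each of [ad], [bad],
[S_n], [S'_n] is a polynomial in these two operators.  Write [x] for left and
[y] for right multiplication; [S] becomes a series [S(x, y)] whose partial sums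
suffice on any given element.

The series is a coboundary on a lattice of points.  With
[theta k = q^(2k) + q^(-2k)], the polynomial of [(bad A)_n] vanishes at
[(theta k, theta l)] whenever [|k - l| < n], so that [S(theta k, theta l)] is a
finite sum, and its value is [t_k / t_l] with [t_k = q^(2 k^2)]
([sterm_sum_theta]).  This is a terminating basic hypergeometric summation; it
is proved here by fixing [u = q^(k+l)] and varying [i = k - l]: both sides obey
the same three-term recurrence in [i], that of the powers [u^(2i)]
([sterm_sum_rec], [sterm_sum_val]).  Moreover [S'(x, y) = S(y, x)].  Hence, on
the lattice, [S(x, y) S'(x, y) = 1] and [S(x, y) S(y, z) = S(x, z)].

It remains to pass from lattice points to identities in the algebra, although
[A] need not be diagonalizable.  Given [X] and [Y], the map sending the
monomial [x^a y^b z^c] to [A^a X A^b Y A^c] turns the second identity into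
[S(X) S(Y) = S(X Y)] and the first, with [Y] left out, into
[S (S' X) = X = S' (S X)].  So it is enough that this map kills every
polynomial vanishing at all lattice points [(theta k, theta l, theta h)] with
[k] large, [|k - l|] and [|l - h|] small ([detects2], [detects3]).  The
variables are removed one at a time ([detects_ext]): since [Y] is killed by
some [(bad A)_n], a polynomial in [z] may be reduced modulo the polynomial of
[(bad A)_n] in [y] and [z], which is monic in [z] up to a unit; for fixed [x]
and [y] on the lattice the remainder has more distinct roots than its degree
allows, so its coefficients vanish on the lattice of the remaining variables.
At the last stage a polynomial in [x] alone has infinitely many roots, because
[q] is not a root of unity and thus [theta] is injective. *)

Set Implicit Arguments.
Unset Strict Implicit.
Unset Printing Implicit Defensive.
Import GRing.Theory.
Local Open Scope ring_scope.

(** * The operators as polynomials in two commuting variables *)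

Section Symbols.
Variables (F : fieldType) (q : F) (C : comNzRingType) (k : {rmorphism F -> C}).

Definition ad_poly (r : int) (x y : C) : C := k (q ^ r) * x - k (q ^ (- r)) * y.

Definition bad_poly n (x y : C) : C :=
  if n is 0 then k (qdiff q 1)^-1 * ad_poly 0 x y
  else k (qdiff q (2 * n) * qdiff q (2 * n + 1))^-1 *
         (k (qdiff q (2 * n) ^+ 2) + ad_poly n%:Z x y * ad_poly (- n%:Z) x y).

Definition badp_poly n (x y : C) : C := \prod_(i < n) bad_poly i x y.

(** The sequence [r] selects the series: [r n = n] gives the terms of [S], and
[r n = - n] those of [S']. *)
Definition sterm_poly (r : nat -> int) n (x y : C) : C :=
  if n is 0 then 1
  else k (qdiff q (2 * n))^-1 * (badp_poly n x y * ad_poly (r n) x y).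

Arguments sterm_poly : simpl never.

Definition sterm_sum r N (x y : C) : C := \sum_(n < N) sterm_poly r n x y.

Lemma sterm_sumS r N x y :
  sterm_sum r N.+1 x y = sterm_sum r N x y + sterm_poly r N x y.
Proof. exact: big_ord_recr. Qed.

Lemma ad_polyC r x y : ad_poly (- r) x y = - ad_poly r y x.
Proof. by rewrite /ad_poly opprK opprB. Qed.

Lemma bad_polyC n x y : bad_poly n.+1 x y = bad_poly n.+1 y x.
Proof.
by rewrite /bad_poly !ad_polyC !mulrN [ad_poly _ x y * _]mulrC.
Qed.

Lemma badp_polyC n x y : badp_poly n.+1 x y = - badp_poly n.+1 y x.
Proof.
rewrite /badp_poly !big_ord_recl /= -mulNr; congr (_ * _); last first.
  by apply: eq_bigr => i _; exact: bad_polyC.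
by rewrite -mulrN -ad_polyC oppr0.
Qed.

(** Two signs cancel: exchanging the variables turns [ad_(-n)] into [- ad_n]
and, among the factors of [badp_poly], changes the sign of [bad_0] alone. *)
Lemma sterm_polyC n x y :
  sterm_poly (fun n => - n%:Z) n x y = sterm_poly Posz n y x.
Proof.
by case: n => // n; rewrite /sterm_poly badp_polyC ad_polyC mulrNN.
Qed.

Lemma sterm_sumC N x y :
  sterm_sum (fun n => - n%:Z) N x y = sterm_sum Posz N y x.
Proof. by apply: eq_bigr => n _; exact: sterm_polyC. Qed.

End Symbols.

Arguments sterm_poly : simpl never.

Section SymbolMorphism.
Variables (F : fieldType) (q : F) (C D : comNzRingType).
Variables (k : {rmorphism F -> C}) (l : {rmorphism F -> D}).
Variable e : {rmorphism C -> D}.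
Hypothesis ek : forall a, e (k a) = l a.

Lemma rmorph_ad_poly r x y : e (ad_poly q k r x y) = ad_poly q l r (e x) (e y).
Proof. by rewrite rmorphB !rmorphM !ek. Qed.

Lemma rmorph_badp_poly n x y :
  e (badp_poly q k n x y) = badp_poly q l n (e x) (e y).
Proof.
rewrite rmorph_prod; apply: eq_bigr => -[[|i] _] _ /=.
  by rewrite rmorphM ek rmorph_ad_poly.
by rewrite rmorphM rmorphD rmorphM !ek !rmorph_ad_poly.
Qed.

Lemma rmorph_sterm_sum r N x y :
  e (sterm_sum q k r N x y) = sterm_sum q l r N (e x) (e y).
Proof.
rewrite rmorph_sum; apply: eq_bigr => -[[|n] _] _ /=; first exact: rmorph1.
by rewrite !rmorphM ek rmorph_badp_poly rmorph_ad_poly.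
Qed.
End SymbolMorphism.

(** * Summation of the series at lattice points *)

Section Scalars.
Variables (F : fieldType) (q : F).
Hypotheses (q_neq0 : q != 0) (q_nroot : not_root_of_unity q).

Let qn0 n : q ^+ n != 0. Proof. exact: expf_neq0. Qed.

Lemma qdiff_neq0 n : (0 < n)%N -> qdiff q n != 0.
Proof.
move=> n0; rewrite /qdiff; apply: contraNneq (q_nroot (n := n + n) _).
  move/eqP; rewrite subr_eq0 => /eqP e.
  by rewrite exprD {1}e mulVf.
by rewrite addn_gt0 n0.
Qed.

Definition qdiff_fact m : F := \prod_(j < m) qdiff q j.+1.

Lemma qdiff_fact_neq0 m : qdiff_fact m != 0.
Proof. by apply/prodf_neq0 => j _; exact: qdiff_neq0. Qed.

(** At [b = q^t] this is the falling factorial [[t] [t-1] ... [t-m+1]] with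
[[j] = q^j - q^-j].  Taking [b] as the argument, rather than the exponent [t],
lets [t] be negative. *)
Definition ffallq m (b : F) : F := \prod_(j < m) (b * q ^- j - b^-1 * q ^+ j).

Lemma ffallqSl m b : ffallq m.+1 b = (b - b^-1) * ffallq m (b / q).
Proof.
rewrite /ffallq big_ord_recl expr0 invr1 !mulr1; congr (_ * _).
apply: eq_bigr => i _; rewrite /= /bump /= add1n exprS !invfM invrK.
by rewrite !mulrA.
Qed.

Lemma ffallqSr m b :
  ffallq m.+1 b = ffallq m b * (b * q ^- m - b^-1 * q ^+ m).
Proof. exact: big_ord_recr. Qed.

Lemma ffallq_eq0 m j : (j < m)%N -> ffallq m (q ^+ j) = 0.
Proof.
move=> jm; apply/eqP/prodf_eq0; exists (Ordinal jm) => //=.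
by rewrite divff // mulVf // subrr.
Qed.

(** At [a = q^i] this is the symmetric Gaussian binomial coefficient of
[i + n] over [2 n]. *)
Definition qbin n (a : F) : F := ffallq n.*2 (a * q ^+ n) / qdiff_fact n.*2.

Lemma qbin0 a : qbin 0 a = 1.
Proof. by rewrite /qbin /ffallq /qdiff_fact !big_ord0 divr1. Qed.

Lemma qbin_eq0 n i : (i < n)%N -> qbin n (q ^+ i) = 0.
Proof.
move=> lt_in; rewrite /qbin -exprD ffallq_eq0 ?mul0r //.
by rewrite -addnn ltn_add2r.
Qed.

Definition qbeta j : F := q ^+ j.*2 + q ^- j.*2.

(** A second-order form of the Pascal rule; it mirrors the step
[v Q_n = Q_(n+1) + beta_(n+1) Q_n] for the products [Q_n] below, and this is
what makes the series telescope. *)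
Lemma qbin_rec n a : a != 0 ->
  qbin n.+1 (a * q) + qbin n.+1 (a / q) - qbeta n.+1 * qbin n.+1 a = qbin n a.
Proof.
move=> a0; rewrite /qbin /qbeta.
set b := a * q ^+ n.+1.
have -> : a * q * q ^+ n.+1 = b * q by rewrite mulrAC.
have -> : a / q * q ^+ n.+1 = b / q by rewrite mulrAC.
have -> : a * q ^+ n = b / q by rewrite /b exprSr mulrA mulfK.
have b0 : b != 0 by rewrite mulf_neq0.
rewrite doubleS; set m := n.*2.
have := qdiff_fact_neq0 m.+2.
rewrite {1}/qdiff_fact !big_ord_recr /= -/(qdiff_fact m).
rewrite !mulf_eq0 !negb_or => /andP[/andP[f0 d1] d2].
have -> : ffallq m.+2 (b * q) = (b * q - (b * q)^-1) * (b - b^-1)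
    * ffallq m (b / q) by rewrite !ffallqSl mulfK // mulrA.
have -> : ffallq m.+2 b = (b - b^-1) * ffallq m (b / q)
    * ((b / q) * q ^- m - (b / q)^-1 * q ^+ m).
  by rewrite ffallqSl ffallqSr mulrA.
have -> : ffallq m.+2 (b / q) = ffallq m (b / q)
    * ((b / q) * q ^- m - (b / q)^-1 * q ^+ m)
    * ((b / q) * q ^- m.+1 - (b / q)^-1 * q ^+ m.+1) by rewrite !ffallqSr.
have -> : qdiff_fact m.+2 = qdiff_fact m * qdiff q m.+1 * qdiff q m.+2.
  by rewrite /qdiff_fact !big_ord_recr.
move: d1 d2; rewrite /qdiff !exprSr.
have := qn0 m; move: (q ^+ m) => c c0.
move: (ffallq m _) f0 => K f0 d1 d2.
have sq_neq1 (x : F) : x != 0 -> x - x^-1 != 0 -> x * x - 1 != 0.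
  move=> x0 nz; have <- : x * (x - x^-1) = x * x - 1 by rewrite mulrBr divff.
  by rewrite mulf_neq0.
by field; rewrite f0 q_neq0 c0 b0 !sq_neq1 // !mulf_neq0.
Qed.

(** The argument [q ^+ i / q] is the index [i - 1], which is [-1] at [i = 0]. *)
Lemma qbin_eq0V n i : (i <= n)%N -> qbin n.+1 (q ^+ i / q) = 0.
Proof.
move=> le_in; rewrite /qbin exprS mulrA mulfVK // -exprD ffallq_eq0 ?mul0r //.
by rewrite doubleS -addnn ltnS leqW // leq_add2r.
Qed.

(** The points are parametrized so that [x = u a + (u a)^-1] and
[y = u / a + a / u]: then [x] and [y] are the lattice points [k] and [l] when
[u = q^(k+l)] and [a = q^(k-l)].  The dependence on [u] separates from the
dependence on [a] in each factor of [badp_poly], which is what this choice is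
for. *)
Section Summation.
Variable u : F.
Hypothesis u0 : u != 0.
Let v := u ^+ 2 + u ^- 2.
Let xval a : F := u * a + (u * a)^-1.
Let yval a : F := u / a + a / u.

Let Q n : F := \prod_(j < n) (v - qbeta j.+1).

Let h n (a : F) : F :=
  (u - u^-1) * Q n * (u * qbin n a - u^-1 * qbin n (a / q)).

Lemma ad_poly_val n a : a != 0 ->
  ad_poly q idfun n%:Z (xval a) (yval a) =
    u * (a * q ^+ n - (a * q ^+ n)^-1) - u^-1 * (a * q ^- n - (a * q ^- n)^-1).
Proof.
move=> a0; rewrite /ad_poly /xval /yval /= -exprnN -exprnP.
have := qn0 n; move: (q ^+ n) => c c0.
by field; rewrite a0 u0 c0.
Qed.

Lemma badp_poly_val n a : a != 0 ->
  badp_poly q idfun n.+1 (xval a) (yval a) =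
    (u - u^-1) * Q n * (ffallq n.*2.+1 (a * q ^+ n) / qdiff_fact n.*2.+1).
Proof.
move=> a0; elim: n => [|n IHn].
  rewrite /badp_poly /Q /ffallq /qdiff_fact !big_ord_recl !big_ord0 /=.
  rewrite /ad_poly /xval /yval /qdiff.
  have := qdiff_neq0 (isT : 0 < 1)%N; rewrite /qdiff.
  rewrite !expr1 !expr0 oppr0 !expr0z => d0.
  by move: (q - q^-1) d0 => d d0; field; rewrite a0 u0 d0 oner_neq0.
rewrite /badp_poly big_ord_recr /= -/(badp_poly _ _ _ _ _) IHn.
rewrite /Q big_ord_recr /= -/(Q n) doubleS.
rewrite (ffallqSl n.*2.+2) (ffallqSr n.*2.+1).
have -> : a * q ^+ n.+1 / q = a * q ^+ n by rewrite exprSr mulrA mulfK.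
have -> : qdiff_fact n.*2.+3
    = qdiff_fact n.*2.+1 * qdiff q n.*2.+2 * qdiff q n.*2.+3.
  by rewrite /qdiff_fact !big_ord_recr.
rewrite addn1 mul2n doubleS.
have f0 := qdiff_fact_neq0 n.*2.+1.
have d2 := qdiff_neq0 (isT : 0 < n.*2.+2)%N.
have d3 := qdiff_neq0 (isT : 0 < n.*2.+3)%N.
have -> : qdiff q n.*2.+2 ^+ 2 + ad_poly q idfun n.+1%:Z (xval a) (yval a)
    * ad_poly q idfun (- n.+1%:Z) (xval a) (yval a)
  = (v - qbeta n.+1) * ((a * q ^+ n.+1) - (a * q ^+ n.+1)^-1)
      * (a * q ^- n.+1 - (a * q ^- n.+1)^-1).
  rewrite /ad_poly /xval /yval /= opprK -exprnN -exprnP /qdiff /qbeta /v doubleS.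
  have -> : n.*2.+2 = (n.+1 + n.+1)%N by rewrite addnn.
  rewrite exprD.
  have := qn0 n.+1; move: (q ^+ n.+1) => c c0.
  by field; rewrite a0 u0 c0.
have -> : a * q ^+ n * q ^- n.*2.+1 = a * q ^- n.+1.
  rewrite -addnn -addnS exprD; have := qn0 n; have := qn0 n.+1.
  by move: (q ^+ n) (q ^+ n.+1) => c d c0 d0; field; rewrite c0.
have -> : (a * q ^+ n)^-1 * q ^+ n.*2.+1 = (a * q ^- n.+1)^-1.
  rewrite -addnn -addnS exprD; have := qn0 n; have := qn0 n.+1.
  by move: (q ^+ n) (q ^+ n.+1) => c d c0 d0; field; rewrite a0 c0.
move: (qdiff q n.*2.+2) (qdiff q n.*2.+3) (qdiff_fact _) d2 d3 f0.
move=> d2 d3 f d20 d30 f0.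
have := qn0 n.+1; move: (q ^+ n.+1) => c c0.
by field; rewrite a0 u0 c0 f0 d20 d30.
Qed.

Lemma sterm_poly_val n a : a != 0 ->
  sterm_poly q idfun Posz n.+1 (xval a) (yval a) =
  (u - u^-1) * Q n * (u * qbin n.+1 a - u^-1 * qbin n.+1 (a / q)).
Proof.
move=> a0; rewrite /sterm_poly badp_poly_val // ad_poly_val // mul2n /qbin.
have -> : a / q * q ^+ n.+1 = a * q ^+ n by rewrite exprS mulrA mulfVK.
rewrite doubleS (ffallqSl n.*2.+1 (_ * q ^+ n.+1)) (ffallqSr n.*2.+1).
have -> : a * q ^+ n.+1 / q = a * q ^+ n by rewrite exprSr mulrA mulfK.
have -> : qdiff_fact n.*2.+2 = qdiff_fact n.*2.+1 * qdiff q n.*2.+2.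
  by rewrite /qdiff_fact !big_ord_recr.
have f0 := qdiff_fact_neq0 n.*2.+1.
have d2 := qdiff_neq0 (isT : 0 < n.*2.+2)%N.
have -> : a * q ^+ n * q ^- n.*2.+1 = a * q ^- n.+1.
  rewrite -addnn -addnS exprD; have := qn0 n; have := qn0 n.+1.
  by move: (q ^+ n) (q ^+ n.+1) => c d c0 d0; field; rewrite c0.
have -> : (a * q ^+ n)^-1 * q ^+ n.*2.+1 = (a * q ^- n.+1)^-1.
  rewrite -addnn -addnS exprD; have := qn0 n; have := qn0 n.+1.
  by move: (q ^+ n) (q ^+ n.+1) => c d c0 d0; field; rewrite a0 c0.
move: (qdiff q n.*2.+2) (qdiff_fact _) d2 f0.
move=> d2 f d20 f0; rewrite /=.
have := qn0 n.+1; move: (q ^+ n.+1) => c c0.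
by field; rewrite a0 u0 c0 f0 d20.
Qed.

(** As functions of [i], where [a = q^i], the terms satisfy the recurrence
of [u^(2i)] up to the difference of two consecutive values of [h]. *)
Lemma sterm_poly_rec n a : a != 0 ->
  sterm_poly q idfun Posz n.+1 (xval (a * q)) (yval (a * q))
  + sterm_poly q idfun Posz n.+1 (xval (a / q)) (yval (a / q))
  - v * sterm_poly q idfun Posz n.+1 (xval a) (yval a) = h n a - h n.+1 a.
Proof.
move=> a0; have aq0 : a * q != 0 by rewrite mulf_neq0.
have aV0 : a / q != 0 by rewrite mulf_neq0 ?invr_neq0.
rewrite !sterm_poly_val // /h -!(qbin_rec n) // mulfK // mulfVK //.
have -> : Q n.+1 = Q n * (v - qbeta n.+1) by rewrite /Q big_ord_recr.
by ring.
Qed.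

Lemma sterm_sum_rec N a : a != 0 ->
  sterm_sum q idfun Posz N.+1 (xval (a * q)) (yval (a * q))
  + sterm_sum q idfun Posz N.+1 (xval (a / q)) (yval (a / q))
  - v * sterm_sum q idfun Posz N.+1 (xval a) (yval a) = - h N a.
Proof.
move=> a0; elim: N => [|N IHN].
  rewrite /sterm_sum !big_ord_recl !big_ord0 /sterm_poly /= /h !qbin0.
  rewrite /Q big_ord0 /v.
  by field.
rewrite !(sterm_sumS _ _ _ N.+1).
have -> : - h N.+1 a = - h N a + (h N a - h N.+1 a) by ring.
rewrite -sterm_poly_rec // -IHN.
by ring.
Qed.

(** The error term [h N (q ^+ i)] vanishes for [i < N], so the partial sum and
[u^(2i)] satisfy the same recurrence, and they agree at [i = 0] and [i = 1]. *)
Lemma sterm_sum_val N i : (i <= N)%N ->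
  sterm_sum q idfun Posz N.+1 (xval (q ^+ i)) (yval (q ^+ i)) = u ^+ i.*2.
Proof.
suff: (forall N, i <= N ->
    sterm_sum q idfun Posz N.+1 (xval (q ^+ i)) (yval (q ^+ i)) = u ^+ i.*2)%N
  /\ (forall N, i.+1 <= N ->
    sterm_sum q idfun Posz N.+1 (xval (q ^+ i.+1)) (yval (q ^+ i.+1))
    = u ^+ i.+1.*2)%N by move=> [] + _; apply.
elim: i {N} => [|i [IH0 IH1]].
  split=> [N _|N N1].
    rewrite /sterm_sum big_ord_recl big1 /= ?addr0 // => j _.
    rewrite sterm_poly_val ?oner_neq0 // qbin_eq0 // qbin_eq0V //.
    by rewrite !mulr0 subrr mulr0.
  case: N N1 => // N _; rewrite /sterm_sum 2!big_ord_recl big1 /=; last first.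
    move=> j _; rewrite sterm_poly_val // qbin_eq0 // qbin_eq0V //.
    by rewrite !mulr0 subrr mulr0.
  have := qbin_rec 0 (oner_neq0 F); rewrite !qbin0 mul1r.
  rewrite (qbin_eq0V (leq0n 0)) (qbin_eq0 (ltn0Sn 0)) mulr0 subr0 addr0 => e1.
  rewrite /bump /= addr0 expr1 sterm_poly_val // e1 divff //.
  rewrite (qbin_eq0 (ltn0Sn 0)) /Q big_ord0 [in LHS]/sterm_poly.
  by field.
split=> // N lt_iN.
have := sterm_sum_rec N (qn0 i.+1).
have -> : q ^+ i.+1 / q = q ^+ i by rewrite exprSr mulfK.
rewrite -exprSr.
rewrite IH0 ?IH1 ?(ltnW lt_iN) //; last by rewrite ltnW // ltnW.
case: N lt_iN => // N lt_iN.
rewrite /h qbin_eq0 // qbin_eq0V // !mulr0 subrr mulr0 oppr0.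
move/eqP; rewrite -addrA addr_eq0 opprB => /eqP->.
rewrite /v !doubleS !exprS; have := expf_neq0 i.*2 u0.
by move: (u ^+ i.*2) => c c0; field.
Qed.
End Summation.

Definition theta k : F := q ^+ k.*2 + q ^- k.*2.

(** Because [theta k - theta l] factors as
[(q^(2k) - q^(2l)) (1 - q^(-2k-2l))]. *)
Lemma theta_inj : injective theta.
Proof.
move=> k l.
wlog le_kl : k l / (k <= l)%N.
  by move=> W /[dup] e /esym e'; case/orP: (leq_total k l) => /W -> //.
rewrite -(subnKC le_kl); move: (l - k)%N => {le_kl}d.
case: d => [|d]; first by rewrite addn0.
rewrite /theta doubleD exprD => e.
have n1 : q ^+ d.+1.*2 != 1 by apply: q_nroot; rewrite doubleS.
have n2 : q ^+ (k.*2 + d.+1.*2 + k.*2) != 1.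
  by apply: q_nroot; rewrite doubleS addnS.
have: (q ^+ d.+1.*2 - 1) * (q ^+ (k.*2 + d.+1.*2 + k.*2) - 1) != 0.
  by rewrite mulf_neq0 // subr_eq0.
case/eqP; move: e; rewrite !exprD; have := qn0 k.*2; have := qn0 d.+1.*2.
move: (q ^+ k.*2) (q ^+ _) => b c c0 b0 e.
have -> : (c - 1) * (b * c * b - 1) = b * c * ((b * c + (b * c)^-1) - (b + b^-1)).
  by field; rewrite b0.
by rewrite e subrr mulr0.
Qed.

(** The closed form of the series at lattice points is the quotient of two of
these weights, so products of its values telescope. *)
Definition tweight k : F := q ^+ (2 * k ^ 2).

Lemma tweight_neq0 k : tweight k != 0. Proof. exact: qn0. Qed.

(** For [l <= k] take [u = q^(k+l)] and [i = k - l]; for [k <= l] take the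
inverse of [u], as [theta] is even. *)
Lemma sterm_sum_theta N k l : (k < l + N)%N -> (l < k + N)%N ->
  sterm_sum q idfun Posz N (theta k) (theta l) = tweight k / tweight l.
Proof.
case: N => [|N]; first by rewrite !addn0 => /ltnW; rewrite leqNgt => /negP.
case/orP: (leq_total l k) => /subnKC <-.
  move: (k - l)%N => i; rewrite ltn_add2l ltnS => le_iN _.
  have := sterm_sum_val (qn0 (l + i + l)) le_iN.
  have -> : q ^+ (l + i + l) * q ^+ i = q ^+ (l + i).*2.
    by rewrite -exprD -addnn addnA addnAC.
  have -> : q ^+ (l + i + l) / q ^+ i = q ^+ l.*2.
    by rewrite addnAC exprD mulfK // addnn.
  have -> : q ^+ i / q ^+ (l + i + l) = q ^- l.*2.
    rewrite addnAC exprD addnn invfM [_^-1 * _^-1]mulrC mulrA divff // mul1r //.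
  rewrite -/(theta _) -/(theta _) => ->; rewrite -exprM /tweight.
  apply: (canRL (mulfK _)); rewrite ?qn0 // -exprD; congr (_ ^+ _).
  by rewrite -muln2; ring.
move: (l - k)%N => i _; rewrite ltn_add2l ltnS => le_iN.
have u0 : q ^- (k + i + k) != 0 by rewrite invr_eq0.
have := sterm_sum_val u0 le_iN; rewrite invfM !invrK.
have -> : q ^- (k + i + k) * q ^+ i = q ^- k.*2.
  by rewrite addnAC exprD invfM mulfVK // addnn.
have -> : q ^+ (k + i + k) * q ^- i = q ^+ k.*2.
  by rewrite addnAC exprD mulfK // addnn.
have -> : q ^- (k + i + k) / q ^+ i = q ^- (k + i).*2.
  by rewrite -invfM -exprD -addnn addnA addnAC.
have -> : q ^+ i * q ^+ (k + i + k) = q ^+ (k + i).*2.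
  by rewrite mulrC -exprD -addnn addnA addnAC.
rewrite ![_^-1 + _]addrC -/(theta _) -/(theta _) => ->; rewrite exprVn -exprM /tweight.
apply: (canRL (mulfK _)); rewrite ?qn0 //.
apply: (canLR (mulKf _)); rewrite ?qn0 // -exprD; congr (_ ^+ _).
by rewrite -muln2; ring.
Qed.
End Scalars.

(** * The operators as monic polynomials *)

Section Monic.
Variables (F : fieldType) (q : F).
Hypotheses (q_neq0 : q != 0) (q_nroot : not_root_of_unity q).

(** Up to a scalar, the polynomial of [(bad A)_(m+1)]; this form is monic in
[y].  The factor of index [j] has the roots [theta (a - j - 1)] and
[theta (a + j + 1)] when [x = theta a]. *)
Definition bad_prod (C : comNzRingType) (k : {rmorphism F -> C}) m (x y : C) :=
  (y - x) * \prod_(j < m)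
    (y ^+ 2 + (- (k (qbeta q j.+1) * x) * y + (x ^+ 2 + k (qdiff q j.+1.*2 ^+ 2)))).

Lemma rmorph_bad_prod (C D : comNzRingType) (k : {rmorphism F -> C})
    (l : {rmorphism F -> D}) (e : {rmorphism C -> D}) m x y :
  (forall a, e (k a) = l a) ->
  e (bad_prod k m x y) = bad_prod l m (e x) (e y).
Proof.
move=> ek; rewrite rmorphM rmorphB rmorph_prod; congr (_ * _).
by apply: eq_bigr => j _; rewrite !(rmorphD e) ek !(rmorphM e) (rmorphN e) (rmorphM e) ek.
Qed.

Lemma bad_poly_monic (C : comNzRingType) (k : {rmorphism F -> C}) j x y :
  bad_poly q k j.+1 x y = k (qdiff q j.+1.*2 * qdiff q j.+1.*2.+1)^-1 *
  (y ^+ 2 + (- (k (qbeta q j.+1) * x) * y + (x ^+ 2 + k (qdiff q j.+1.*2 ^+ 2)))).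
Proof.
rewrite /bad_poly mul2n addn1; congr (_ * _).
rewrite /ad_poly opprK -exprnN -exprnP /qbeta -addnn exprD invfM.
have : k (q ^+ j.+1) * k (q ^- j.+1) = 1.
  by rewrite -rmorphM divff ?rmorph1 // expf_neq0.
rewrite (rmorphD k) !(rmorphM k (q ^+ _)) (rmorphM k (q ^- _)).
move: (k (_ ^+ 2)); move: (k (q ^+ _)) (k (q ^- _)) => a b d ab.
transitivity (d + (a * b) * (x ^+ 2 + y ^+ 2) - (a * a + b * b) * x * y).
  by ring.
by rewrite ab; ring.
Qed.

Lemma badp_poly_monic m : exists2 c : F, c != 0 &
  forall (C : comNzRingType) (k : {rmorphism F -> C}) x y,
  badp_poly q k m.+1 x y = k c * bad_prod k m x y.
Proof.
elim: m => [|m [c c0 IHm]].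
  exists (- (qdiff q 1)^-1).
    by rewrite oppr_eq0 invr_eq0 qdiff_neq0.
  move=> C k x y; rewrite /badp_poly /bad_prod big_ord_recl !big_ord0 /=.
  by rewrite /ad_poly oppr0 expr0z rmorph1 rmorphN; ring.
exists (c * (qdiff q m.+1.*2 * qdiff q m.+1.*2.+1)^-1).
  by rewrite mulf_neq0 // invr_eq0 mulf_neq0 // qdiff_neq0.
move=> C k x y; rewrite /badp_poly big_ord_recr -/(badp_poly _ _ _ _ _) IHm.
rewrite [nat_of_ord _]/= bad_poly_monic /bad_prod big_ord_recr /= (rmorphM k c).
by move: (\prod_(i < m) _) (k _^-1) => p d; ring.
Qed.

Lemma bad_prodC (C : comNzRingType) (k : {rmorphism F -> C}) m x y :
  bad_prod k m x y = - bad_prod k m y x.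
Proof.
rewrite /bad_prod -mulNr opprB; congr (_ * _).
by apply: eq_bigr => j _; ring.
Qed.

Lemma bad_prod_theta m a b : (a <= b + m)%N -> (b <= a + m)%N ->
  bad_prod (idfun : F -> F) m (theta q a) (theta q b) = 0.
Proof.
wlog le_ab : a b / (a <= b)%N.
  move=> W le1 le2; case/orP: (leq_total a b) => [le_ab|le_ba]; first exact: W.
  by rewrite bad_prodC W ?oppr0.
move=> _; rewrite -(subnKC le_ab); move: (b - a)%N => {le_ab b} d.
rewrite leq_add2l => le_dm; apply/eqP; rewrite mulf_eq0.
case: d le_dm => [|d] le_dm; first by rewrite addn0 subrr eqxx.
apply/orP; right; apply/prodf_eq0; exists (Ordinal le_dm) => //=.
rewrite /theta /qbeta /qdiff doubleD exprD.
have := expf_neq0 a.*2 q_neq0; have := expf_neq0 d.+1.*2 q_neq0.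
by move: (q ^+ _) (q ^+ _) => c b b0 c0; apply/eqP; field; rewrite b0 c0.
Qed.

Lemma bad_prod_monic (C : comNzRingType) (k : {rmorphism F -> C}) m (y : C) :
  let d := bad_prod (polyC \o k) m y%:P 'X in
  d \is monic /\ size d = m.*2.+2.
Proof.
rewrite /bad_prod.
have quad (b c : C) :
    ('X ^+ 2 + (- b%:P * 'X + c%:P) : {poly C}) \is monic /\
    size ('X ^+ 2 + (- b%:P * 'X + c%:P) : {poly C}) = 3.
  have lt : (size (- b%:P * 'X + c%:P)%R < size ('X^2 : {poly C})%R)%N.
    rewrite size_polyXn (leq_ltn_trans (size_polyD _ _)) // gtn_max.
    rewrite (leq_ltn_trans (size_polyC_leq1 _)) // andbT -polyCN.
    by rewrite (leq_ltn_trans (size_polyMleq _ _)) // size_polyX addn2 /= ltnS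
      ltnS size_polyC_leq1.
  by rewrite monicE lead_coefDl // size_polyDl // size_polyXn lead_coefXn eqxx.
elim: m => [|m [IH1 IH2]].
  by rewrite big_ord0 mulr1 monicXsubC size_XsubC.
rewrite big_ord_recr /= mulrA.
have := quad (k (qbeta q m.+1) * y) (y ^+ 2 + k (qdiff q m.+1.*2 ^+ 2)).
rewrite polyCD polyCM polyC_exp => -[q1 q2]; split; first by rewrite monicMl.
by rewrite size_Mmonic ?monic_neq0 // IH2 q2 addn3.
Qed.
End Monic.

(** * Evaluating polynomials on the algebra *)

Section Representation.
Variables (F : fieldType) (q : F) (AA : algType F) (A : AA).
Hypotheses (q_neq0 : q != 0) (q_nroot : not_root_of_unity q).

Definition sterm (r : nat -> int) n (X : AA) : AA :=
  if n is 0 then X else (qdiff q (2 * n))^-1 *: badp q A n (ad q A (r n) X).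

Definition spart r N X : AA := \sum_(n < N) sterm r n X.

Lemma badpS n X : badp q A n.+1 X = badp q A n (bad q A n X).
Proof.
rewrite /badp /index_iota !subn0 -addn1 iotaD add0n.
have bigE (g : AA -> AA) s Z : (\big[comp/g]_(i <- s) bad q A i) Z
    = (\big[comp/id]_(i <- s) bad q A i) (g Z).
  by elim: s Z => [|i s IHs] Z; rewrite ?big_nil // !big_cons /= IHs.
have catE s Z : (\big[comp/id]_(i <- s ++ [:: n]) bad q A i) Z
    = (\big[comp/id]_(i <- s) bad q A i) (bad q A n Z).
  elim: s Z => [|i s IHs] Z; last by rewrite !big_cons /= IHs.
  by rewrite big_cons !big_nil.
exact: catE.
Qed.

Lemma badp0 X : badp q A 0 X = X.
Proof. by rewrite /badp big_nil. Qed.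

(** This makes one induction along the definitions of [ad], [bad] and [S_n]
serve twice: for [phi c = X], with [phi] a representation of [C],
and for [X] acting inside an extended representation as [c] does. *)
Record symbol_rel (C : comNzRingType) (k : {rmorphism F -> C}) (x y : C)
    (R : AA -> C -> Prop) : Prop := SymbolRel {
  rel_l : forall X c, R X c -> R (A * X) (x * c);
  rel_r : forall X c, R X c -> R (X * A) (y * c);
  rel_k : forall a X c, R X c -> R (a *: X) (k a * c);
  rel_D : forall X c Y d, R X c -> R Y d -> R (X + Y) (c + d) }.

Section Transport.
Variables (C : comNzRingType) (k : {rmorphism F -> C}) (x y : C).
Variable R : AA -> C -> Prop.
Hypothesis rel : symbol_rel k x y R.

Lemma transport_ad r X c : R X c -> R (ad q A r X) (ad_poly q k r x y * c).
Proof.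
move=> RXc; rewrite /ad /ad_poly mulrBl -!mulrA -scaleNr -mulNr -rmorphN.
by apply: (rel_D rel); apply: (rel_k rel); [apply: (rel_l rel) | apply: (rel_r rel)].
Qed.

Lemma transport_bad n X c : R X c -> R (bad q A n X) (bad_poly q k n x y * c).
Proof.
case: n => [|n] RXc; rewrite /bad /bad_poly -mulrA; apply: (rel_k rel).
  exact: transport_ad.
rewrite mulrDl; apply: (rel_D rel); first exact: (rel_k rel).
by rewrite -mulrA; do 2!apply: transport_ad.
Qed.

Lemma transport_badp n X c : R X c -> R (badp q A n X) (badp_poly q k n x y * c).
Proof.
elim: n X c => [|n IHn] X c RXc.
  by rewrite badp0 /badp_poly big_ord0 mul1r.
rewrite badpS /badp_poly big_ord_recr /= -mulrA.
by apply: IHn; apply: transport_bad.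
Qed.

Lemma transport_sterm r n X c :
  R X c -> R (sterm r n X) (sterm_poly q k r n x y * c).
Proof.
case: n => [|n] RXc; rewrite /sterm /sterm_poly ?mul1r // -!mulrA.
by apply: (rel_k rel); apply: transport_badp; apply: transport_ad.
Qed.

Lemma transport_spart r N X c :
  R X c -> R (spart r N X) (sterm_sum q k r N x y * c).
Proof.
move=> RXc; rewrite /spart /sterm_sum mulr_suml.
apply: (big_ind2 R) => [||n _]; last exact: transport_sterm.
  by rewrite -(scale0r X) -(mul0r c) -(rmorph0 k); apply: (rel_k rel).
by move=> *; apply: (rel_D rel).
Qed.
End Transport.

(** The map [ext phi X] adjoins one variable to [phi]: it sends [c 'X^i] to
[phi c * X * A^i].  Iterated from the evaluation of [{poly F}] at [A], it gives
the maps [x^a y^b |-> A^a X A^b] and [x^a y^b z^c |-> A^a X A^b Y A^c]. *)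
Section Ext.
Variables (C : comNzRingType) (phi : {additive C -> AA}) (X : AA).

Definition ext (f : {poly C}) : AA :=
  \sum_(i < size f) phi f`_i * X * A ^+ i.

Lemma ext_wide n (f : {poly C}) : (size f <= n)%N ->
  ext f = \sum_(i < n) phi f`_i * X * A ^+ i.
Proof.
move=> le_fn; rewrite /ext (big_ord_widen _ (fun i => phi f`_i * X * A ^+ i) le_fn).
rewrite big_mkcond; apply: eq_bigr => i _; case: ltnP => // le_fi.
by rewrite nth_default // raddf0 !mul0r.
Qed.

Fact ext_is_zmod_morphism : zmod_morphism ext.
Proof.
move=> f g; pose n := maxn (size f) (size g).
rewrite !(@ext_wide n) ?leq_maxl ?leq_maxr //; last first.
  by rewrite (leq_trans (size_polyD _ _)) // size_polyN.
rewrite -sumrB; apply: eq_bigr => i _.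
by rewrite coefB raddfB !mulrBl.
Qed.
HB.instance Definition _ := GRing.isZmodMorphism.Build {poly C} AA ext
  ext_is_zmod_morphism.

Lemma extC c : ext c%:P = phi c * X.
Proof.
rewrite (@ext_wide 1) ?size_polyC_leq1 // big_ord1 coefC eqxx.
by rewrite expr0 mulr1.
Qed.

Lemma ext_mulC c f :
  ext (c%:P * f) = \sum_(i < size f) phi (c * f`_i) * X * A ^+ i.
Proof.
rewrite (@ext_wide (size f)); last by rewrite mul_polyC size_scale_leq.
by apply: eq_bigr => i _; rewrite coefCM.
Qed.

Lemma ext_mulX f : ext ('X * f) = ext f * A.
Proof.
rewrite (@ext_wide (size f).+1); last first.
  by rewrite (leq_trans (size_polyMleq _ _)) // size_polyX.
rewrite big_ord_recl coefXM raddf0 !mul0r add0r mulr_suml.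
by apply: eq_bigr => i _; rewrite coefXM lift0 /= exprSr !mulrA.
Qed.
End Ext.

(** In an iterated [ext], [x] is the first variable and [y] the last one. *)
Record symbol_rep (C : comNzRingType) (k : {rmorphism F -> C}) (x y : C)
    (phi : {additive C -> AA}) : Prop := SymbolRep {
  rep_l : forall c, phi (x * c) = A * phi c;
  rep_r : forall c, phi (y * c) = phi c * A;
  rep_k : forall a c, phi (k a * c) = a *: phi c }.

Section RepTheory.
Variables (C : comNzRingType) (k : {rmorphism F -> C}) (x y : C).
Variable phi : {additive C -> AA}.
Hypothesis rep : symbol_rep k x y phi.

Lemma symbol_rep_ext X : symbol_rep (polyC \o k) x%:P 'X (ext phi X).
Proof.
split=> [f|f|a f]; last 1 first.
- rewrite /= ext_mulC /ext scaler_sumr; apply: eq_bigr => i _.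
  by rewrite (rep_k rep) -!scalerAl.
- rewrite /= ext_mulC /ext mulr_sumr; apply: eq_bigr => i _.
  by rewrite (rep_l rep) !mulrA.
exact: ext_mulX.
Qed.

Lemma rep_rel : symbol_rel k x y (fun X c => phi c = X).
Proof.
split=> [X c <-|X c <-|a X c <-|X c Y d <- <-].
- exact: rep_l rep _.
- exact: rep_r rep _.
- exact: rep_k rep _ _.
by rewrite raddfD.
Qed.

Lemma rep_ad r c : phi (ad_poly q k r x y * c) = ad q A r (phi c).
Proof. exact: (transport_ad rep_rel). Qed.

Lemma rep_badp n c : phi (badp_poly q k n x y * c) = badp q A n (phi c).
Proof. exact: (transport_badp rep_rel). Qed.

Lemma rep_spart r N c : phi (sterm_sum q k r N x y * c) = spart r N (phi c).
Proof. exact: (transport_spart rep_rel). Qed.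

(** In [phi c * Y * A^i], multiplying [Y] by [A] on the left amounts to
multiplying [c] by [y], and on the right to multiplying by the new variable. *)
Lemma ext_rel X : symbol_rel (polyC \o k) y%:P 'X
  (fun Y c => forall f, ext phi X (c * f) = ext phi Y f).
Proof.
split=> [Y c XYc f|Y c XYc f|a Y c XYc f|Y c Z d XYc XZd f].
- rewrite [y%:P * c]mulrC -mulrA XYc ext_mulC.
  by apply: eq_bigr => i _; rewrite (rep_r rep) !mulrA.
- rewrite ['X * c]mulrC -mulrA XYc ext_mulX mulr_suml.
  by apply: eq_bigr => i _; rewrite -!mulrA -exprSr exprS.
- rewrite -mulrA (rep_k (symbol_rep_ext X)) /= XYc scaler_sumr.
  by apply: eq_bigr => i _; rewrite -scalerAr -scalerAl.
rewrite mulrDl raddfD /= XYc XZd -big_split.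
by apply: eq_bigr => i _; rewrite mulrDr mulrDl.
Qed.

Lemma ext_badp n X f :
  ext phi X (badp_poly q (polyC \o k) n y%:P 'X * f) = ext phi (badp q A n X) f.
Proof.
rewrite -[badp_poly _ _ _ _ _]mulr1.
by apply: (transport_badp (ext_rel X)) => g; rewrite mul1r.
Qed.

Lemma ext_spart r N X f :
  ext phi X (sterm_sum q (polyC \o k) r N y%:P 'X * f) =
  ext phi (spart r N X) f.
Proof.
rewrite -[sterm_sum _ _ _ _ _ _]mulr1.
by apply: (transport_spart (ext_rel X)) => g; rewrite mul1r.
Qed.
End RepTheory.

Definition detects (C : comNzRingType) (phi : C -> AA) (I : Type)
    (P : I -> Prop) (ev : I -> {rmorphism C -> F}) :=
  forall c, (forall i, P i -> ev i c = 0) -> phi c = 0.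

(** Here [pos i] is the lattice index of the last variable at the point [i], and
a point of the extended family adds a lattice index [l] at distance at most [m]
from it.  The bound [m <= pos i] leaves room for [2 m + 1] such indices. *)
Section Detect.
Variables (C : comNzRingType) (k : {rmorphism F -> C}) (x y : C).
Variable phi : {additive C -> AA}.
Hypothesis rep : symbol_rep k x y phi.
Variables (I : Type) (P : I -> Prop) (ev : I -> {rmorphism C -> F}).
Variables (pos : I -> nat) (m : nat) (X : AA).
Hypotheses (ev_k : forall i a, ev i (k a) = a)
  (ev_y : forall i, ev i y = theta q (pos i))
  (P_pos : forall i, P i -> (m <= pos i)%N)
  (phi_detect : detects phi P ev)
  (X_killed : badp q A m.+1 X = 0).

Definition ev_ext (il : I * nat) : {rmorphism {poly C} -> F} :=
  horner_eval (theta q il.2) \o map_poly (ev il.1).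

Definition pos_ext (il : I * nat) := il.2.

Definition P_ext (il : I * nat) :=
  [/\ P il.1, (pos il.1 <= il.2 + m)%N & (il.2 <= pos il.1 + m)%N].

Lemma ev_extC il c : ev_ext il c%:P = ev il.1 c.
Proof. by rewrite /ev_ext /= map_polyC /horner_eval hornerC. Qed.

Lemma ev_extX il : ev_ext il 'X = theta q il.2.
Proof. by rewrite /ev_ext /= map_polyX /horner_eval hornerX. Qed.

Lemma ev_ext_k il a : ev_ext il ((polyC \o k) a) = a.
Proof. by rewrite -[RHS](ev_k il.1) -ev_extC. Qed.

(** Modulo the polynomial of [(bad A)_(m+1)], which acts on [X] by [0], the new
variable has degree at most [2 m], while each point [i] offers [2 m + 1]
distinct values for it. *)
Lemma detects_ext : detects (ext phi X) P_ext ev_ext.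
Proof.
move=> f f0; set d := bad_prod q (polyC \o k) m y%:P 'X.
have [d_monic d_size] : d \is monic /\ size d = m.*2.+2 by exact: bad_prod_monic.
have d_killed u : ext phi X (d * u) = 0.
  have [c c0 dE] := badp_poly_monic q_neq0 q_nroot m.
  apply: (scalerI c0); rewrite scaler0 -(rep_k (symbol_rep_ext rep X)) mulrA -dE.
  apply: etrans (ext_badp rep m.+1 X u) _.
  by rewrite X_killed /ext big1 // => i _; rewrite mulr0 mul0r.
have := Pdiv.RingMonic.rdivp_eq d_monic f.
set u := Pdiv.Ring.rdivp _ _; set r := Pdiv.Ring.rmodp _ _ => fE.
have r_size : (size r <= m.*2.+1)%N.
  by rewrite -ltnS -d_size Pdiv.Ring.ltn_rmodpN0 // monic_neq0.
have ev_r i : P i -> map_poly (ev i) r = 0.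
  move=> Pi; pose s := [seq theta q l | l <- iota (pos i - m) m.*2.+1].
  have s_size : size s = m.*2.+1 by rewrite size_map size_iota.
  apply: (@roots_geq_poly_eq0 _ _ s); last first.
  - by rewrite s_size (leq_trans (size_poly _ _)).
  - by rewrite (map_inj_uniq (theta_inj q_neq0 q_nroot)) iota_uniq.
  apply/allP => _ /mapP[l + ->]; rewrite mem_iota => /andP[l1 l2].
  have le1 : (pos i <= l + m)%N by lia.
  have le2 : (l <= pos i + m)%N by have := P_pos Pi; lia.
  have := f0 (i, l) (And3 Pi le1 le2); rewrite fE rmorphD rmorphM.
  rewrite (rmorph_bad_prod q m _ _ (l := idfun) (ev_ext_k (i, l))).
  rewrite ev_extC ev_extX ev_y bad_prod_theta // mulr0 add0r => e.
  exact/rootP.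
rewrite fE mulrC raddfD /= d_killed add0r /ext big1 // => j _.
rewrite phi_detect ?mul0r // => i /ev_r/(congr1 (fun p : {poly F} => p`_j)).
by rewrite coef_map coef0.
Qed.
End Detect.
End Representation.

(** * Identities between partial sums *)

Section Identities.
Variables (F : fieldType) (q : F) (AA : algType F) (A : AA).
Hypotheses (q_neq0 : q != 0) (q_nroot : not_root_of_unity q).

Let phi1 : {additive {poly F} -> AA} := horner_alg A.
Let phi2 X : {additive {poly {poly F}} -> AA} := ext A phi1 X.
Let phi3 X Y : {additive {poly {poly {poly F}}} -> AA} := ext A (phi2 X) Y.
Let k1 : {rmorphism F -> {poly F}} := polyC.
Let k2 : {rmorphism F -> {poly {poly F}}} := polyC \o k1.
Let k3 : {rmorphism F -> {poly {poly {poly F}}}} := polyC \o k2.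
Let x2 : {poly {poly F}} := 'X%:P.

Lemma symbol_rep1 : symbol_rep A k1 'X 'X phi1.
Proof.
split=> [c|c|a c]; rewrite /phi1 /k1 /=.
- by rewrite rmorphM /= horner_algX.
- by rewrite mulrC rmorphM /= horner_algX.
by rewrite rmorphM /= horner_algC mulr_algl.
Qed.

Lemma symbol_rep2 X : symbol_rep A k2 x2 'X (phi2 X).
Proof. exact: (symbol_rep_ext symbol_rep1). Qed.

Lemma symbol_rep3 X Y : symbol_rep A k3 x2%:P 'X (phi3 X Y).
Proof. exact: (symbol_rep_ext (symbol_rep2 X)). Qed.

Lemma phi2_1 X : phi2 X 1 = X.
Proof. by rewrite /phi2 /= extC /= rmorph1 mul1r. Qed.

Lemma phi3C X Y c : phi3 X Y c%:P = phi2 X c * Y.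
Proof. by rewrite /phi3 /= extC. Qed.

Lemma phi2_killed m X c : badp q A m X = 0 ->
  phi2 X (badp_poly q k2 m x2 'X * c) = 0.
Proof.
move=> mX; apply: etrans (ext_badp q symbol_rep1 m X c) _.
by rewrite mX /ext big1 // => i _; rewrite mulr0 mul0r.
Qed.

Lemma badp_mono m n X : (m <= n)%N -> badp q A m X = 0 -> badp q A n X = 0.
Proof.
move=> /subnKC <- mX; rewrite -[X in LHS]phi2_1 -(rep_badp q (symbol_rep2 X)).
by rewrite /badp_poly big_split_ord /= -mulrA phi2_killed.
Qed.

Lemma badp_ad_eq0 n r X : badp q A n X = 0 -> badp q A n (ad q A r X) = 0.
Proof.
move=> nX; have rep := symbol_rep2 X.
rewrite -[X in ad _ _ _ X]phi2_1 -(rep_ad q rep) -(rep_badp q rep).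
exact: phi2_killed.
Qed.

Lemma Ssum_spart m N X : (0 < m <= N)%N -> badp q A m X = 0 ->
  Ssum q A X = spart q A Posz N X /\
  Ssum' q A X = spart q A (fun n => - n%:Z) N X.
Proof.
move=> /andP[m0 le_mN] mX.
suff E (f : nat -> AA) : (forall n, (0 < n)%N -> badp q A n X = 0 -> f n = 0) ->
    \sum_(n \in @setT nat) f n = \sum_(n < N) f n.
  split; apply: E => -[//|n] _ nX; rewrite /Sterm /Sterm' badp_ad_eq0 //;
  exact: scaler0.
move=> f0; rewrite fsbig_ord; apply/esym/fsbig_widen => // n [_ /= /negP].
rewrite -leqNgt => le_Nn.
apply: f0; first by rewrite (leq_trans m0) ?(leq_trans le_mN).
exact: badp_mono (leq_trans le_mN le_Nn) mX.
Qed.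

Definition ev1 k : {rmorphism {poly F} -> F} := horner_eval (theta q k).

Lemma detects1 K : detects phi1 (fun k => K <= k)%N ev1.
Proof.
move=> c c0; suff -> : c = 0 by rewrite raddf0.
apply: (@roots_geq_poly_eq0 _ _ [seq theta q l | l <- iota K (size c)]).
- by apply/allP => _ /mapP[l + ->]; rewrite mem_iota => /andP[/c0/eqP].
- by rewrite (map_inj_uniq (theta_inj q_neq0 q_nroot)) iota_uniq.
by rewrite size_map size_iota.
Qed.

Let ev2 := ev_ext q ev1.
Let ev3 := ev_ext q ev2.

Lemma ev1_k k a : ev1 k (k1 a) = a. Proof. by rewrite /= /horner_eval hornerC. Qed.
Lemma ev1_x k : ev1 k 'X = theta q k.
Proof. by rewrite /= /horner_eval hornerX. Qed.

Lemma ev2_k kl a : ev2 kl (k2 a) = a. Proof. exact: (ev_ext_k q ev1_k). Qed.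
Lemma ev2_x kl : ev2 kl x2 = theta q kl.1.
Proof. by rewrite /ev2 /x2 ev_extC ev1_x. Qed.
Lemma ev2_y kl : ev2 kl 'X = theta q kl.2. Proof. exact: ev_extX. Qed.
Lemma ev3_k klh a : ev3 klh (k3 a) = a. Proof. exact: (ev_ext_k q ev2_k). Qed.

Lemma ev3C klh c : ev3 klh c%:P = ev2 klh.1 c. Proof. exact: ev_extC. Qed.
Lemma ev3_z klh : ev3 klh 'X = theta q klh.2. Proof. exact: ev_extX. Qed.

Lemma detects2 K m X : (m <= K)%N -> badp q A m.+1 X = 0 ->
  detects (phi2 X) (P_ext (fun k => K <= k)%N id m) ev2.
Proof.
move=> le_mK mX.
apply: (detects_ext q_neq0 q_nroot symbol_rep1 ev1_k ev1_x _ _ mX).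
  by move=> k; apply: leq_trans.
exact: detects1.
Qed.

(** From [m + n <= k] and [|k - l| <= m] follows [n <= l], the room needed for
the indices [h] with [|l - h| <= n]. *)
Lemma detects3 K m n X Y : (m + n <= K)%N ->
  badp q A m.+1 X = 0 -> badp q A n.+1 Y = 0 ->
  detects (phi3 X Y) (P_ext (P_ext (fun k => K <= k)%N id m) (@pos_ext nat) n) ev3.
Proof.
move=> le_mK mX nY.
apply: (detects_ext q_neq0 q_nroot (symbol_rep2 X) ev2_k ev2_y _ _ nY).
  by move=> [k l] [/= leK lek _]; rewrite /pos_ext /=; lia.
by apply: detects2 mX; apply: leq_trans le_mK; exact: leq_addr.
Qed.

Lemma spartK N X (neg := fun n => - n%:Z) : badp q A N.+1 X = 0 ->
  spart q A neg N.+1 (spart q A Posz N.+1 X) = X /\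
  spart q A Posz N.+1 (spart q A neg N.+1 X) = X.
Proof.
move=> NX; have rep := symbol_rep2 X.
set S := sterm_sum q k2 Posz N.+1 x2 'X; set S' := sterm_sum q k2 neg N.+1 x2 'X.
have SS' : phi2 X (S * (S' * 1)) = X.
  apply/eqP; rewrite -subr_eq0 -[X in _ - X]phi2_1 -raddfB; apply/eqP.
  apply: (detects2 (leqnn N) NX) => -[k l] [_ le1 le2]; rewrite /= in le1 le2.
  rewrite mulr1 rmorphB rmorphM rmorph1 /S /S'.
  rewrite !(rmorph_sterm_sum q (l := idfun) (ev2_k (k, l))).
  rewrite ev2_x ev2_y sterm_sumC !sterm_sum_theta //= ?addnS ?ltnS //.
  by rewrite mulrA mulfVK ?tweight_neq0 // divff ?tweight_neq0 // subrr.
split; last by rewrite -{2}SS' !(rep_spart q rep) phi2_1.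
by rewrite -{2}SS' mulrCA !(rep_spart q rep) phi2_1.
Qed.

(** This is [S(x, z) = S(x, y) S(y, z)] on the lattice, applied to [X] and [Y].
The left side sums further than the right side because the indices [k] and
[h] attached to [x] and [z] may lie at distance [2 N]. *)
Lemma spartM N X Y : badp q A N.+1 X = 0 -> badp q A N.+1 Y = 0 ->
  spart q A Posz N.*2.+1 (X * Y) = spart q A Posz N.+1 X * spart q A Posz N.+1 Y.
Proof.
move=> NX NY; apply/eqP; rewrite -subr_eq0; apply/eqP.
pose Sxz := sterm_sum q k3 Posz N.*2.+1 x2%:P 'X.
pose Sxy : {poly {poly F}} := sterm_sum q k2 Posz N.+1 x2 'X.
pose Syz := sterm_sum q k3 Posz N.+1 ('X%:P) 'X.
have <- : phi3 X Y (Sxz * 1) = spart q A Posz N.*2.+1 (X * Y).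
  by rewrite (rep_spart q (symbol_rep3 X Y)) -[1]/(1%:P) phi3C phi2_1.
have <- : phi3 X Y (Syz * Sxy%:P) = spart q A Posz N.+1 X * spart q A Posz N.+1 Y.
  apply: etrans (ext_spart q (symbol_rep2 X) Posz N.+1 Y Sxy%:P) _.
  rewrite extC; congr (_ * _); rewrite -[Sxy]mulr1.
  by rewrite (rep_spart q (symbol_rep2 X)) phi2_1.
rewrite -raddfB; apply: (detects3 (leqnn (N + N)) NX NY).
move=> [[k l] h] [[_ le1 le2] le3 le4].
rewrite /pos_ext /= in le1 le2 le3 le4.
rewrite mulr1 rmorphB rmorphM /Sxz /Syz.
rewrite !(rmorph_sterm_sum q (l := idfun) (ev3_k (k, l, h))).
rewrite !ev3C ev3_z ev2_x ev2_y.
rewrite (rmorph_sterm_sum q (l := idfun) (ev2_k (k, l))) ev2_x ev2_y /=.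
rewrite !sterm_sum_theta //; try lia.
by rewrite [X in _ - X]mulrC mulrA mulfVK ?tweight_neq0 // subrr.
Qed.
End Identities.

(** * The automorphisms *)

Section Automorphism.
Variables (F : fieldType) (q : F) (AA : algType F) (A : AA).

Lemma ad_linear r : linear (ad q A r).
Proof.
move=> a X Y; rewrite /ad mulrDr mulrDl -scalerAr -scalerAl !scalerDr !scalerA.
by rewrite ![_ * a]mulrC -!scalerA scalerN opprD addrACA.
Qed.

Lemma bad_linear n : linear (bad q A n).
Proof.
move=> a X Y.
have scalerCA c (Z : AA) : c *: (a *: Z) = a *: (c *: Z).
  by rewrite !scalerA mulrC.
case: n => [|n]; rewrite /bad !ad_linear; first by rewrite scalerDr scalerCA.
rewrite [_ *: (a *: X + Y)]scalerDr addrACA scalerDr.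
by rewrite scalerCA -[a *: _ + a *: _]scalerDr scalerCA.
Qed.

Lemma badp_linear n : linear (badp q A n).
Proof.
move=> a X Y; elim: n X Y => [|n IHn] X Y; first by rewrite !badp0.
by rewrite !badpS bad_linear IHn.
Qed.

Lemma sterm_linear r n : linear (sterm q A r n).
Proof.
move=> a X Y; case: n => [//|n]; rewrite /sterm ad_linear badp_linear.
by rewrite scalerDr !scalerA mulrC.
Qed.

Lemma spart_linear r N : linear (spart q A r N).
Proof.
move=> a X Y; rewrite /spart scaler_sumr -big_split /=.
by apply: eq_bigr => n _; exact: sterm_linear.
Qed.

Hypotheses (q_neq0 : q != 0) (q_nroot : not_root_of_unity q).
Hypothesis A_std : standard_alg q A.

Lemma exists_killer X Y Z : exists N, [/\ badp q A N.+1 X = 0,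
  badp q A N.+1 Y = 0 & badp q A N.+1 Z = 0].
Proof.
have [m _ mX] := A_std X; have [n _ nY] := A_std Y; have [p _ pZ] := A_std Z.
exists (m + n + p)%N.
by split; [move: mX | move: nY | move: pZ]; apply: badp_mono; lia.
Qed.

Lemma SsumE N M X : (N < M)%N -> badp q A N.+1 X = 0 ->
  Ssum q A X = spart q A Posz M X.
Proof. by move=> lt_NM NX; have [] := @Ssum_spart _ q _ A N.+1 M X lt_NM NX. Qed.

Lemma Ssum'E N M X : (N < M)%N -> badp q A N.+1 X = 0 ->
  Ssum' q A X = spart q A (fun n => - n%:Z) M X.
Proof. by move=> lt_NM NX; have [] := @Ssum_spart _ q _ A N.+1 M X lt_NM NX. Qed.

Lemma Ssum_linear : linear (Ssum q A).
Proof.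
move=> a X Y; have [N [NX NY NZ]] := exists_killer X Y (a *: X + Y).
by rewrite !(SsumE (ltnSn N)) // spart_linear.
Qed.

Lemma Ssum1 : Ssum q A 1 = 1.
Proof.
have bad1 : badp q A 1 1 = 0.
  by rewrite badpS badp0 /bad /ad oppr0 mulr1 mul1r subrr scaler0.
by rewrite (SsumE (ltnSn 0)) // /spart big_ord1.
Qed.

Lemma SsumM X Y : Ssum q A (X * Y) = Ssum q A X * Ssum q A Y.
Proof.
have [N [NX NY NXY]] := exists_killer X Y (X * Y).
rewrite (SsumE (ltnSn N) NX) (SsumE (ltnSn N) NY) -spartM //.
by apply: SsumE NXY; rewrite ltnS -addnn leq_addr.
Qed.

Lemma SsumK : cancel (Ssum q A) (Ssum' q A).
Proof.
move=> X; have [N [NX NSX _]] := exists_killer X (Ssum q A X) 0.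
rewrite (Ssum'E (ltnSn N) NSX) (SsumE (ltnSn N) NX).
by have [] := spartK q_neq0 q_nroot NX.
Qed.

Lemma Ssum'K : cancel (Ssum' q A) (Ssum q A).
Proof.
move=> X; have [N [NX NSX _]] := exists_killer X (Ssum' q A X) 0.
rewrite (SsumE (ltnSn N) NSX) (Ssum'E (ltnSn N) NX).
by have [] := spartK q_neq0 q_nroot NX.
Qed.
End Automorphism.

Lemma alg_automorphism_inv (F : fieldType) (AA : algType F) (f g : AA -> AA) :
  cancel f g -> cancel g f -> alg_automorphism f -> alg_automorphism g.
Proof.
move=> fK gK [f_lin [f1 fM] _]; split; last by exists f.
  by move=> a X Y; apply: (can_inj fK); rewrite f_lin !gK.
split; first by rewrite -{1}f1 fK.
by move=> X Y; apply: (can_inj fK); rewrite fM !gK.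
Qed.

Theorem theorem5p4 (F : fieldType) (q : F) (q_neq0 : q != 0)
    (q_nroot : not_root_of_unity q)
    (AA : algType F) (A : AA) (A_std : standard_alg q A) :
  [/\ alg_automorphism (Ssum q A), alg_automorphism (Ssum' q A),
      cancel (Ssum q A) (Ssum' q A) & cancel (Ssum' q A) (Ssum q A)].
Proof.
have SK := SsumK q_neq0 q_nroot A_std.
have S'K := Ssum'K q_neq0 q_nroot A_std.
have S_aut : alg_automorphism (Ssum q A).
  split; [exact: Ssum_linear | split | by exists (Ssum' q A)].
    exact: Ssum1.
  exact: SsumM.
by split=> //; apply: alg_automorphism_inv S_aut.
Qed.
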